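(* Let $R$ be a finite modular lattice with $n$ elements, and let $\sigma$ be a linear extension of $R$. Then for every $x\in R$, \[|\mathrm{Cov}_R^\uparrow(\mathrm{Ech}_\sigma(x))|=|\mathrm{Cov}_R^\downarrow(x)|.\]
   Context: For a finite poset $R$ with $n$ elements, $y$ covers $x$ (written $x\lessdot y$) if $x<y$ and there is no $z$ with $x<z<y$. A linear extension of $R$ is a bijection $\sigma\colon R\to[n]$ with $\sigma(x)\le\sigma(y)$ whenever $x\le y$. The Cartan matrix $W^{R,\sigma}$ is the $n\times n$ matrix with $(i,j)$-entry $1$ if $\sigma^{-1}(i)\ge\sigma^{-1}(j)$ and $0$ otherwise; it is lower unitriangular, hence invertible. By the Bruhat decomposition $\mathrm{GL}_n(\mathbb C)=\bigsqcup_{P}BPB$ (union over $n\times n$ permutation matrices $P$, with $B$ the group of invertible upper-triangular complex matrices), there is a unique permutation matrix $P^{R,\sigma}$ with $W^{R,\sigma}\in BP^{R,\sigma}B$. Echelonmotion $\mathrm{Ech}_\sigma\colon R\to R$ is the bijection with $\mathrm{Ech}_\sigma(x)=y$ iff $P^{R,\sigma}_{\sigma(y),\sigma(x)}=1$. A finite lattice is modular if $a\vee(x\wedge b)=(a\vee x)\wedge b$ for all $a,b,x$ with $a\le b$. For $x\in R$, $\mathrm{Cov}_R^\downarrow(x)=\{y\in R: y\lessdot x\}$ and $\mathrm{Cov}_R^\uparrow(x)=\{y\in R: x\lessdot y\}$. *)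

(* Defs.v *)
From mathcomp Require Import all_boot all_order all_algebra.
From mathcomp Require Import complex.
From mathcomp Require Import boolp classical_sets reals.

Set Implicit Arguments.
Unset Strict Implicit.
Unset Printing Implicit Defensive.

Import Order.TTheory GRing.Theory Num.Theory.

Local Open Scope order_scope.

Section Poset.
Context {d : Order.disp_t} {R : finPOrderType d}.
Implicit Types x y z : R.

Definition covered_by x y : bool :=
  (x < y) && ~~ [exists z, (x < z) && (z < y)].

Definition cov_down x : {set R} := [set y | covered_by y x].
Definition cov_up x : {set R} := [set y | covered_by x y].

End Poset.

(* The inverse is bundled with the bijection because the Cartan matrix is
   expressed through it.  Ranks are 0, ..., n - 1 rather than 1, ..., n. *)
Record linear_extension (d : Order.disp_t) (R : finPOrderType d) :=
  LinearExtension {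
    lext :> R -> 'I_#|R|;
    lext_inv : 'I_#|R| -> R;
    lextK : cancel lext lext_inv;
    lext_invK : cancel lext_inv lext;
    lext_mono : forall x y : R, x <= y -> (lext x <= lext y)%N
  }.

Definition modular_lattice (d : Order.disp_t) (L : latticeType d) : Prop :=
  forall a b x : L, a <= b -> a `|` (x `&` b) = (a `|` x) `&` b.

Section Bruhat.
Context {F : fieldType} {n : nat}.
Local Open Scope ring_scope.

(* [is_trig_mx] means lower triangular, hence the transpose. *)
Definition borel (B : 'M[F]_n) : Prop := B \in unitmx /\ is_trig_mx B^T.

Definition in_bruhat_cell (P A : 'M[F]_n) : Prop :=
  exists B1 B2 : 'M[F]_n, [/\ borel B1, borel B2 & A = B1 *m P *m B2].

(* By the Bruhat decomposition, exactly one matrix meets the condition when [A]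
   is invertible; the default 0 is then never used. *)
Definition bruhat_perm_mx (A : 'M[F]_n) : 'M[F]_n :=
  xget 0 (fun P : 'M[F]_n => is_perm_mx P /\ in_bruhat_cell P A).

End Bruhat.

Section Echelonmotion.
Variables (K : realType) (d : Order.disp_t) (R : finPOrderType d).
Variable sigma : linear_extension R.

Definition cartan_mx : 'M[K[i]]_#|R| :=
  (\matrix_(i, j) ((lext_inv sigma j <= lext_inv sigma i)%O)%:R)%R.

(* The default [x] is never used: every column of a permutation matrix
   contains exactly one entry equal to 1. *)
Definition echelonmotion (x : R) : R :=
  odflt x [pick y | bruhat_perm_mx cartan_mx (sigma y) (sigma x) == 1%R].

End Echelonmotion.

(* Main.v *)
Require Import Defs.
From mathcomp Require Import all_boot all_order all_algebra.
From mathcomp Require Import complex.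
From mathcomp Require Import boolp classical_sets reals.
From mathcomp Require Import fingroup perm lra zify.

(** Since echelonmotion is a bijection and both cover counts sum to the number
    of edges of the Hasse diagram, it suffices to show that
    |cov_up y| <= |cov_down x| for y = Ech(x).  From W = B1 P B2 one gets a
    column combination g = B2^-1 e_x of W, supported up to x and with pivot at
    row y, and a row combination h = e_y B1^-1, supported from y on and with
    pivot at column x.

    Suppose k = |cov_up y| > |cov_down x|.  If t is the join of the upper
    covers of w, the function mu(-, t) restricted to [w, t] combines the rows
    from w on into the indicator of {z | z \/ w = t}; it has a nonzero
    coefficient at w, and modularity forces |cov_down z| >= |cov_up w| for such
    z.  Hence, on the columns z with |cov_down z| < k, every row w with
    |cov_up w| >= k is a combination of later rows with |cov_up| < k; dually
    for columns.  The dual elimination replaces g by g' supported on columns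
    with |cov_down| < k, with g' x = g x and W g' = W g on the rows with
    |cov_up| < k; these vanish from y on, hence so does all of W g' from y on.
    Then 0 = h W g' = (h W)(x) g'(x) <> 0, a contradiction. *)

Section EchelonmotionCovers.
Set Implicit Arguments.
Unset Strict Implicit.
Import Order.Theory GRing.Theory Num.Theory.
Local Open Scope ring_scope.

(** * Covers in finite posets and in modular lattices *)

Lemma gt_ind (d : Order.disp_t) (R : finPOrderType d) (P : R -> Prop) :
  (forall w, (forall v, (w < v)%O -> P v) -> P w) -> forall w, P w.
Proof.
move=> IH w; have [n] := ubnP #|[set v | (w < v)%O]|.
elim: n w => // n IHn w lewn; apply: IH => v ltwv.
apply: IHn; apply: leq_trans (ltnSE lewn); apply: proper_card.
apply/properP; split; last by exists v; rewrite !inE ?ltxx.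
by apply/fintype.subsetP => u; rewrite !inE; apply: lt_trans.
Qed.

Lemma covered_by_dual (d : Order.disp_t) (R : finPOrderType d) (x y : R) :
  covered_by (x : R^d) y = covered_by y x.
Proof.
by congr (_ && ~~ _); apply: eq_existsb => z; rewrite andbC.
Qed.

Lemma covered_byW (d : Order.disp_t) (R : finPOrderType d) (x y : R) :
  covered_by x y -> (x < y)%O.
Proof. by case/andP. Qed.

Lemma covered_byP (d : Order.disp_t) (R : finPOrderType d) (x y z : R) :
  covered_by x y -> (x <= z)%O -> (z <= y)%O -> z = x \/ z = y.
Proof.
case/andP=> _ /existsPn /(_ z) nz; rewrite le_eqVlt => /predU1P[->|xz]; first by left.
rewrite le_eqVlt => /predU1P[->|zy]; first by right.
by rewrite xz zy in nz.
Qed.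

Lemma ex_coatom (d : Order.disp_t) (R : finPOrderType d) (w t : R) :
  (w < t)%O -> exists2 c, (w <= c)%O & covered_by c t.
Proof.
elim/gt_ind: w => w IH wt; case: (boolP (covered_by w t)) => [cwt|].
  by exists w.
rewrite /covered_by wt negbK => /existsP[z /andP[wz zt]].
by have [c zc ct] := IH z wz zt; exists c => //; apply: le_trans (ltW wz) zc.
Qed.

Lemma modular_dual (d : Order.disp_t) (R : finLatticeType d) :
  modular_lattice R -> modular_lattice (R^d : finLatticeType _).
Proof.
move=> hR a b x ab; have h := hR (b : R) (a : R) (x : R) ab.
change ((a : R) `&` ((x : R) `|` (b : R)) = ((a : R) `&` (x : R)) `|` (b : R))%O.
by rewrite meetC (joinC (x : R)) -h joinC meetC.
Qed.

Section Lattice.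
Variables (d : Order.disp_t) (R : finLatticeType d).
Hypothesis hR : modular_lattice R.
Implicit Types (u v w t c x y z : R).

(** If b lies strictly between y and x \/ y, then x /\ b is x /\ y or x. By modularity b = y \/ (x
    /\ b), so the first case gives b = y; the second gives x \/ y <= b. *)
Lemma covered_by_join x y : covered_by (x `&` y)%O x -> covered_by y (x `|` y)%O.
Proof.
move=> cx; have nxy : ~~ (x <= y)%O.
  by apply/negP => /meet_idPl xy; move/covered_byW: cx; rewrite xy ltxx.
apply/andP; split.
  by rewrite lt_neqAle leUr andbT; apply: contra nxy => /eqP ->; rewrite leUl.
apply/negP => /existsP[b /andP[yb bxy]].
have /eqP := hR x (ltW yb); rewrite (joinC y x).
have -> : ((x `|` y) `&` b = b)%O by apply/meet_idPr/ltW.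
case: (@covered_byP _ _ _ _ (x `&` b)%O cx); rewrite ?leIl //.
- by rewrite leI2 // ltW.
- by move=> ->; rewrite join_l ?leIr // => /eqP yb'; rewrite -yb' ltxx in yb.
- by move/meet_idPl => xb; have := leUx x y b; rewrite xb (ltW yb) (lt_geF bxy).
Qed.

Lemma covered_by_lub_ex w : exists t, [/\ (w <= t)%O,
  forall v, covered_by w v -> (v <= t)%O &
  forall b, (w <= b)%O -> (forall v, covered_by w v -> (v <= b)%O) -> (t <= b)%O].
Proof.
suff [t [wt ht lub]] : exists t, [/\ (w <= t)%O,
    forall v, v \in enum (cov_up w) -> (v <= t)%O &
    forall b, (w <= b)%O -> (forall v, v \in enum (cov_up w) -> (v <= b)%O) ->
      (t <= b)%O].
  exists t; split=> // [v wv|b wb hb]; first by apply: ht; rewrite mem_enum inE.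
  by apply: lub => // v; rewrite mem_enum inE; apply: hb.
elim: (enum _) => [|a s [t [wt ht lub]]]; first by exists w; split.
exists (a `|` t)%O; split=> [|v|b wb hb].
- exact: le_trans wt (leUr _ _).
- rewrite inE => /predU1P[->|/ht vt]; first exact: leUl.
  exact: le_trans vt (leUr _ _).
- rewrite leUx hb ?mem_head //=; apply: lub => // v vs.
  by apply: hb; rewrite inE vs orbT.
Qed.

End Lattice.

(** * Sums over up-sets and down-sets: the zeta matrix *)

Section UpSums.
Variables (d : Order.disp_t) (R : finPOrderType d) (F : fieldType).
Implicit Types (m g f : R -> F).

Lemma up_sum_inj m : (forall u, \sum_(v | (u <= v)%O) m v = 0) -> forall u, m u = 0.
Proof.
move=> h; elim/gt_ind => u IH; have := h u; rewrite (bigD1 u) //=.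
rewrite big1 ?addr0 // => v /andP[uv vu]; apply: IH.
by rewrite lt_neqAle eq_sym vu.
Qed.

(** The A x B block of the zeta matrix has trivial left kernel, so its rank is |A|, which is at most
    its number of columns. *)
Lemma card_le_of_down_sum_inj (A B : {set R}) :
  (forall g, (forall a, a \notin A -> g a = 0) ->
     (forall b, b \in B -> \sum_(a | (a <= b)%O) g a = 0) -> forall a, g a = 0) ->
  (#|A| <= #|B|)%N.
Proof.
move=> inj.
pose M : 'M[F]_(#|A|, #|B|) := \matrix_(i, j) ((enum_val i <= enum_val j)%O)%:R.
suff /eqP <- : row_free M by apply: rank_leq_col.
apply: inj_row_free => v vM.
pose g a := \sum_(i | enum_val i == a) v 0 i.
have gE i : g (enum_val i) = v 0 i.
  rewrite /g (bigD1 i) //= big1 ?addr0 // => j /andP[/eqP/enum_val_inj ->].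
  by rewrite eqxx.
have g0 a : a \notin A -> g a = 0.
  move=> aA; rewrite /g big1 // => i /eqP ia; case/negP: aA.
  by rewrite -ia enum_valP.
apply/rowP => i; rewrite mxE -gE; apply: inj => // b bB.
have := congr1 (fun X : 'rV_#|B| => X 0 (enum_rank_in bB b)) vM.
rewrite mxE [RHS]mxE => e; rewrite -[RHS]e (bigID (mem A)) /= addrC big1 ?add0r; last first.
  by move=> a /andP[_ /g0].
rewrite (eq_bigl (fun a => (a \in A) && (a <= b)%O)); last by move=> a; rewrite andbC.
rewrite big_mkcondr big_enum_val /=; apply: eq_bigr => j _.
rewrite !mxE enum_rankK_in // gE.
by case: ifP; rewrite ?mulr1 ?mulr0.
Qed.

(** The zeta matrix is square with trivial left kernel by [up_sum_inj]. Taking for f the indicator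
    of t yields the Moebius function mu(-, t). *)
Lemma up_sum_surj f : exists m, forall u, \sum_(v | (u <= v)%O) m v = f u.
Proof.
pose M : 'M[F]_#|R| := \matrix_(i, j) ((enum_val j <= enum_val i)%O)%:R.
have sumE (v : 'rV_#|R|) j :
    (v *m M) 0 j = \sum_(u | (enum_val j <= u)%O) v 0 (enum_rank u).
  rewrite mxE (reindex (@enum_val R predT)) /=; last exact/onW_bij/enum_val_bij.
  rewrite [RHS]big_mkcond; apply: eq_bigr => i _; rewrite mxE enum_valK.
  by case: ifP; rewrite ?mulr1 ?mulr0.
have Mu : M \in unitmx.
  rewrite -row_free_unit; apply: inj_row_free => v vM; apply/rowP => i.
  rewrite mxE -(enum_valK i).
  apply: (@up_sum_inj (fun u => v 0 (enum_rank u))) => u.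
  by have := sumE v (enum_rank u); rewrite enum_rankK vM mxE.
pose w : 'rV[F]_#|R| := \row_j f (enum_val j).
exists (fun u => (w *m invmx M) 0 (enum_rank u)) => u.
have := sumE (w *m invmx M) (enum_rank u).
by rewrite mulmxKV // enum_rankK => <-; rewrite mxE enum_rankK.
Qed.

End UpSums.

(** * Moebius functions of a modular lattice and annihilators *)

Section Mobius.
Variables (d : Order.disp_t) (R : finLatticeType d).
Hypothesis hR : modular_lattice R.
Implicit Types (u v w t c x y z : R).

Lemma covered_by_meet x y : covered_by y (x `|` y)%O -> covered_by (x `&` y)%O x.
Proof.
have := @covered_by_join _ _ (modular_dual hR) (y : R^d) (x : R^d).
rewrite !covered_by_dual => h cy; rewrite meetC; apply: h.
by move: cy; rewrite joinC.
Qed.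

(** The top of the interval [w, t] is the join of its atoms. Only covers of w below t enter, so that
    the property passes to [u, t] for u in [w, t]. *)
Definition join_of_covers w t := (w <= t)%O /\
  forall b, (w <= b)%O -> (forall v, covered_by w v -> (v <= t)%O -> (v <= b)%O) ->
    (t <= b)%O.

(** An atom a of [w, t] either lies below u or meets u in w; in the latter case a \/ u is an atom of
    [u, t]. So a bound for the atoms of [u, t] bounds those of [w, t]. *)
Lemma join_of_coversW w u t :
  join_of_covers w t -> (w <= u)%O -> (u <= t)%O -> join_of_covers u t.
Proof.
move=> [wt lub] wu ut; split=> // b ub hb.
apply: lub => [|a wa at_]; first exact: le_trans ub.
case: (@covered_byP _ _ _ _ (a `&` u)%O wa); rewrite ?leIl ?lexI ?wu ?(ltW (covered_byW wa)) //.
  move=> e; apply: le_trans (hb (a `|` u)%O _ _); rewrite ?leUl //.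
    by apply: covered_by_join => //; rewrite e.
  by rewrite leUx at_.
by move/meet_idPl => au; apply: le_trans ub.
Qed.

Section MobiusFunction.
(** Here m is mu(-, t). Its values are rational because the nonvanishing proof compares signs. *)
Variables (t : R) (m : R -> rat).
Hypothesis mE : forall u, \sum_(v | (u <= v)%O) m v = (u == t)%:R.

Lemma mobius_support v : ~~ (v <= t)%O -> m v = 0.
Proof.
elim/gt_ind: v => v IH vt; have := mE v; rewrite (bigD1 v) //= big1 => [|u /andP[vu uv]].
  by rewrite addr0 => ->; case: eqP vt => // ->; rewrite lexx.
apply: IH; first by rewrite lt_neqAle eq_sym uv.
by apply: contra vt; apply: le_trans.
Qed.

(* Weisner's theorem. *)
Lemma mobius_weisner c w : (c < t)%O -> \sum_(v | (v `&` c == w)%O) m v = 0.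
Proof.
(* Summing over all w above u collects m over the v with u <= v /\ c. There are none unless u <= c,
   and then the total is the indicator of u = t, which is 0 since c < t. *)
move=> ct; apply: (up_sum_inj (m := fun w => \sum_(v | (v `&` c == w)%O) m v)) => u.
transitivity (\sum_(v | (u <= v `&` c)%O) m v).
  rewrite [RHS](partition_big (fun v => v `&` c)%O (fun w => (u <= w)%O)) //=.
  apply: eq_bigr => w' uw'; apply: eq_bigl => v.
  by case: eqP => [->|]; rewrite ?uw' ?andbF.
case: (boolP (u <= c)%O) => uc; last first.
  by rewrite big_pred0 // => v; rewrite lexI (negbTE uc) andbF.
rewrite (eq_bigl (fun v => (u <= v)%O)); last by move=> v; rewrite lexI uc andbT.
by rewrite mE; case: eqP uc => // ->; rewrite (lt_geF ct).
Qed.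

(* By Weisner's theorem for a coatom [c], [m w] is minus the sum of [m v] over
   covers [v] of [w]; two such [v] have a common cover, so their values have
   the same sign. *)
Lemma mobius_sign w : join_of_covers w t ->
  m w != 0 /\ forall v, covered_by w v -> (v <= t)%O -> m v * m w < 0.
Proof.
elim/gt_ind: w => w IH jw; have [wt lub] := jw.
have [wet|nwt] := eqVneq w t.
  split=> [|v wv vt]; last first.
    by have := lt_le_trans (covered_byW wv) vt; rewrite wet ltxx.
  have := mE w; rewrite (bigD1 w) //= big1 => [|v /andP[wv vw]].
    by rewrite addr0 => ->; rewrite wet eqxx.
  apply: mobius_support; apply: contra vw => vt.
  by rewrite eq_le wv wet vt.
have ltwt : (w < t)%O by rewrite lt_neqAle nwt.
have [c wc ct] := ex_coatom ltwt.
have [s [ws st sc]] : exists s, [/\ covered_by w s, (s <= t)%O & ~~ (s <= c)%O].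
  apply: contrapT => h; have : (t <= c)%O.
    apply: lub => // v wv vt; apply: contrapT => /negP vc; apply: h.
    by exists v.
  by rewrite (lt_geF (covered_byW ct)).
have pos v v' : covered_by w v -> (v <= t)%O -> covered_by w v' -> (v' <= t)%O ->
    0 < m v * m v'.
  move=> wv vt wv' vt'.
  have [mv0 hv] := IH v (covered_byW wv) (join_of_coversW jw (ltW (covered_byW wv)) vt).
  have [mv'0 hv'] :=
    IH v' (covered_byW wv') (join_of_coversW jw (ltW (covered_byW wv')) vt').
  have [<-|nvv'] := eqVneq v v'; first by rewrite -expr2 lt_def sqr_ge0 sqrf_eq0 mv0.
  have vIv' : (v `&` v' = w)%O.
    case: (@covered_byP _ _ _ _ (v `&` v')%O wv) => //.
    - by rewrite lexI !(ltW (covered_byW _)).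
    - exact: leIl.
    move/meet_idPl => le_vv'; case: (covered_byP wv' (ltW (covered_byW wv)) le_vv').
      by move=> e; have := covered_byW wv; rewrite e ltxx.
    by move/eqP; rewrite (negbTE nvv').
  have ut : (v `|` v' <= t)%O by rewrite leUx vt.
  have h1 := hv _ (_ : covered_by v (v `|` v')%O) ut.
  have h2 := hv' _ (_ : covered_by v' (v `|` v')%O) ut.
  have {}h1 : m (v `|` v')%O * m v < 0.
    by apply: h1; rewrite joinC; apply: covered_by_join; rewrite // meetC vIv'.
  have {}h2 : m (v `|` v')%O * m v' < 0.
    by apply: h2; apply: covered_by_join; rewrite // vIv'.
  by nra.
have mw : m w = - \sum_(v | (v `&` c == w)%O && (v != w)) m v.
  have := mobius_weisner w (covered_byW ct); rewrite (bigD1 w) /=.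
    by move/eqP; rewrite addr_eq0 => /eqP.
  by apply/eqP/meet_idPl.
have sc_w : (s `&` c = w)%O.
  case: (@covered_byP _ _ _ _ (s `&` c)%O ws) => //.
  - by rewrite lexI wc (ltW (covered_byW ws)).
  - exact: leIl.
  by move/meet_idPl; rewrite (negbTE sc).
(* Such a v is not below c, so v \/ c = t covers c, and therefore v covers v /\ c = w. *)
have cov v : (v `&` c)%O = w -> v != w -> (v <= t)%O -> covered_by w v.
  move=> vc vw vt; rewrite -vc meetC; rewrite meetC; apply: covered_by_meet.
  suff -> : (v `|` c = t)%O by [].
  case: (@covered_byP _ _ _ _ (v `|` c)%O ct); rewrite ?leUr ?leUx ?vt ?(ltW (covered_byW ct)) //.
  move=> e; have vlec : (v <= c)%O by rewrite -e leUl.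
  by rewrite -vc (meet_l vlec) eqxx in vw.
(* In m v0 times the sum of the m v, the term of s is strictly positive and the others are
   nonnegative; those with v not below t vanish. *)
have neg v0 : covered_by w v0 -> (v0 <= t)%O -> m v0 * m w < 0.
  move=> wv0 v0t; rewrite mw mulrN oppr_lt0 mulr_sumr (bigD1 s) /=; last first.
    by rewrite sc_w eqxx; apply: contraTneq (covered_byW ws) => ->; rewrite ltxx.
  apply: ltr_wpDr; last exact: pos.
  apply: sumr_ge0 => v /andP[/andP[/eqP vc vw] _].
  case: (boolP (v <= t)%O) => vt; last by rewrite (mobius_support vt) mulr0.
  by apply/ltW/pos => //; apply: cov.
split=> //; apply/eqP => mw0; have := neg s ws st.
by rewrite mw0 mulr0 ltxx.
Qed.

End MobiusFunction.

(* A function on [w] and its covers is determined by its sums below [t] and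
   below the coatoms of [[w, t]]: the other sums follow because [mu(u, t)] does
   not vanish. *)
Lemma card_cov_up_le_coatoms w t : join_of_covers w t ->
  (forall v, covered_by w v -> (v <= t)%O) ->
  (#|cov_up w| <= #|[set c | covered_by c t && (w <= c)%O]|)%N.
Proof.
move=> jwt cov_le; set D := [set c | _]; have [wt _] := jwt.
have [m mE] := up_sum_surj (fun u : R => (u == t)%:R : rat).
suff : (#|w |: cov_up w| <= #|t |: D|)%N.
  rewrite !cardsU1 !inE /covered_by !ltxx /=; exact: id.
apply: (@card_le_of_down_sum_inj _ _ rat) => g g0 gB.
pose G u := \sum_(a | (a <= u)%O) g a.
have gA a : g a != 0 -> a = w \/ covered_by w a.
  move=> ga; have : a \in w |: cov_up w.
    by apply: contraNT ga => /g0 ->.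
  by rewrite !inE => /predU1P.
(* Pairing mu(-, t) with G above u gives the sum of g a over u \/ a = t. If g a is nonzero, then a =
   w forces u = t, and a cover a of w not below u makes u a coatom; both are excluded. By induction
   only mu(u, t) * G u survives in the pairing. *)
have G0 u : (w <= u)%O -> (u <= t)%O -> G u = 0.
  elim/gt_ind: u => u IH wu ut.
  have [uB|] := boolP (u \in t |: D); first exact: gB.
  rewrite !inE wu andbT negb_or => /andP[nut ncut].
  have [mu0 _] := mobius_sign mE (join_of_coversW jwt wu ut).
  have : \sum_(v | (u <= v)%O) m v * G v = 0.
    under eq_bigr do rewrite /G mulr_sumr.
    rewrite (exchange_big_dep xpredT) //= big1 // => a _.
    rewrite -mulr_suml (eq_bigl (fun v => u `|` a <= v)%O); last first.
      by move=> v; rewrite leUx.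
    rewrite mE; case: eqP => [uat|]; last by rewrite mul0r.
    have [->|ga] := eqVneq (g a) 0; first by rewrite mulr0.
    case: (gA a ga) => [aw|wa].
      by move: uat; rewrite aw join_l // => ut'; rewrite ut' eqxx in nut.
    case: (@covered_byP _ _ _ _ (a `&` u)%O wa).
    - by rewrite lexI wu ltW // covered_byW.
    - exact: leIl.
    - move=> auw; case/negP: ncut; rewrite -uat joinC.
      by apply: covered_by_join => //; rewrite auw.
    - by move/meet_idPl => au; move: uat nut; rewrite join_l // => ->; rewrite eqxx.
  rewrite (bigD1 u) //= big1 ?addr0 => [/eqP|v /andP[uv vu]].
    by rewrite mulf_eq0 (negbTE mu0) /= => /eqP.
  have [vt|vt] := boolP (v <= t)%O; last by rewrite (mobius_support mE vt) mul0r.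
  rewrite IH ?mulr0 //; first by rewrite lt_neqAle eq_sym vu.
  exact: le_trans uv.
have gw : g w = 0.
  rewrite -(G0 w) // /G (bigD1 w) //= big1 ?addr0 // => a /andP[aw naw].
  apply: contraTeq naw => /gA[->|/covered_byW wa]; first by rewrite eqxx.
  by rewrite (lt_geF wa) in aw.
move=> a; apply/eqP; apply: contraT => ga; case: (gA a ga) => [aw|wa].
  by rewrite aw gw eqxx in ga.
case/negP: ga; rewrite -(G0 a (ltW (covered_byW wa)) (cov_le _ wa)) /G.
rewrite (bigD1 a) //= big1 ?addr0 //.
move=> b /andP[ba nba]; apply: contraTeq nba => gb.
case: (gA b gb) => [bw|wb]; first by rewrite bw gw eqxx in gb.
case: (covered_byP wa (ltW (covered_byW wb)) ba) => [bw|->]; last by rewrite eqxx.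
by rewrite bw gw eqxx in gb.
Qed.

(** The map c |-> z /\ c sends these coatoms to lower covers of z, since z \/ c = z \/ w covers c.
    It is injective because modularity recovers c as w \/ (z /\ c). *)
Lemma card_coatoms_le_cov_down w z :
  (#|[set c | covered_by c (z `|` w)%O && (w <= c)%O]| <= #|cov_down z|)%N.
Proof.
set D := [set c | _].
have Dinj : {in D &, injective (fun c => z `&` c)%O}.
  suff K : {in D, forall c, (w `|` (z `&` c) = c)%O} by apply: can_in_inj K.
  move=> c; rewrite inE => /andP[ct wc].
  by rewrite hR // joinC meetC meet_l // ltW // covered_byW.
rewrite -(card_in_imset Dinj); apply/subset_leq_card/fintype.subsetP => _ /imsetP[c + ->].
rewrite !inE => /andP[ct wc]; apply: covered_by_meet.
suff -> : (z `|` c = z `|` w)%O by [].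
case: (@covered_byP _ _ _ _ (z `|` c)%O ct) => //; first exact: leUr.
  by rewrite leUx leUl ltW // covered_byW.
move=> zc; have : (z `|` w <= c)%O by rewrite leUx wc -zc leUl.
by rewrite (lt_geF (covered_byW ct)).
Qed.

Lemma ex_up_annihilator (F : numFieldType) w : exists m : R -> F, [/\ m w != 0,
  forall v, ~~ (w <= v)%O -> m v = 0 &
  forall z, (#|cov_down z| < #|cov_up w|)%N -> \sum_(v | (z <= v)%O) m v = 0].
Proof.
have [t [wt cov_le lub]] := covered_by_lub_ex w.
have jwt : join_of_covers w t.
  by split=> // b wb hb; apply: lub => // v wv; apply: hb => //; apply: cov_le.
have [m mE] := up_sum_surj (fun u : R => (u == t)%:R : rat).
have [mw0 _] := mobius_sign mE jwt.
(* Cutting off outside the up-set of w turns a sum over v >= z into one over v >= z \/ w, that is,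
   into the indicator of z \/ w = t. *)
exists (fun v => if (w <= v)%O then ratr (m v) else 0); split.
- by rewrite lexx fmorph_eq0.
- by move=> v /negbTE ->.
move=> z ltzw; rewrite -big_mkcondr /=.
rewrite (eq_bigl (fun v => z `|` w <= v)%O); last by move=> v; rewrite leUx.
rewrite -rmorph_sum mE; case: eqP => [zwt|]; last by rewrite rmorph0.
have := card_cov_up_le_coatoms jwt cov_le; rewrite -zwt => h.
by have := leq_trans h (card_coatoms_le_cov_down w z); rewrite leqNgt ltzw.
Qed.

End Mobius.

Lemma ex_down_annihilator (d : Order.disp_t) (R : finLatticeType d)
    (F : numFieldType) (x : R) : modular_lattice R ->
  exists m : R -> F, [/\ m x != 0, forall v, ~~ (v <= x)%O -> m v = 0 &
  forall z, (#|cov_up z| < #|cov_down x|)%N -> \sum_(v | (v <= z)%O) m v = 0].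
Proof.
move=> hR; have [m [mx m0 hm]] := ex_up_annihilator (modular_dual hR) F (x : R^d).
have upE (z : R) : #|cov_up (z : R^d)| = #|cov_down z|.
  by apply: eq_card => y; rewrite !inE covered_by_dual.
have downE (z : R) : #|cov_down (z : R^d)| = #|cov_up z|.
  by apply: eq_card => y; rewrite !inE covered_by_dual.
exists m; split=> // z; rewrite -upE -downE; exact: hm.
Qed.

(** * Column elimination and the inequality at a pivot *)

Section Pivot.
Variables (d : Order.disp_t) (R : finLatticeType d) (F : numFieldType).
Hypothesis hR : modular_lattice R.
Variable s : R -> nat.
Hypotheses (s_inj : injective s) (s_mono : forall u v, (u <= v)%O -> (s u <= s v)%N).
Implicit Types (u v w x y z : R) (g h m : R -> F).

Lemma sum_mul_down_up g m :
  \sum_w m w * (\sum_(z | (z <= w)%O) g z) = \sum_z g z * (\sum_(w | (z <= w)%O) m w).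
Proof.
under eq_bigr do rewrite mulr_sumr.
rewrite (exchange_big_dep xpredT) //=; apply: eq_bigr => z _.
by rewrite mulr_sumr; apply: eq_bigr => w _; rewrite mulrC.
Qed.

(* Columns are eliminated from [x] down, each by means of earlier ones. *)
Lemma eliminate_columns k x g : (#|cov_down x| < k)%N ->
  (forall z, (s x < s z)%N -> g z = 0) ->
  exists g', [/\ g' x = g x, forall z, (s x < s z)%N -> g' z = 0,
    forall z, (k <= #|cov_down z|)%N -> g' z = 0 &
    forall w, (#|cov_up w| < k)%N ->
      \sum_(z | (z <= w)%O) g' z = \sum_(z | (z <= w)%O) g z].
Proof.
move=> xk g0.
(* Here n counts the positions already treated, going down from s x; n = s x + 1 reaches position
   0. *)
suff H n : exists g', [/\ g' x = g x, forall z, (s x < s z)%N -> g' z = 0,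
    forall z, (k <= #|cov_down z|)%N -> ((s x).+1 - n <= s z)%N -> g' z = 0 &
    forall w, (#|cov_up w| < k)%N ->
      \sum_(z | (z <= w)%O) g' z = \sum_(z | (z <= w)%O) g z].
  have [g' [g'x g'0 g'k g'E]] := H (s x).+1; exists g'; split=> // z zk.
  by apply: g'k; rewrite ?subnn.
elim: n => [|n [g' [g'x g'0 g'k g'E]]].
  by exists g; split=> // z _; rewrite subn0; apply: g0.
have [[z [zk zn]]|none] :=
    pselect (exists z, (k <= #|cov_down z|)%N /\ s z = ((s x).+1 - n.+1)%N); last first.
  exists g'; split=> // z zk; rewrite leq_eqVlt => /predU1P[zn|zn].
    by case: none; exists z.
  by apply: g'k => //; apply: leq_trans zn; rewrite subSS -addn1 leq_subLR addnC; lia.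
have [m [mz m0 mE]] := ex_down_annihilator F z hR.
have coef0 v : v != z -> (s z <= s v)%N -> m v = 0.
  move=> vz szv; apply: m0; apply: contra vz => /s_mono svz.
  by apply/eqP/s_inj/eqP; rewrite eqn_leq svz.
have szx : (s z <= s x)%N by rewrite zn subSS leq_subr.
(* The coefficient kills the value at z. As m is supported below z, later positions are unchanged;
   its sums below w vanish when |cov_up w| < k <= |cov_down z|. *)
exists (fun v => g' v - g' z / m z * m v); split.
- rewrite (coef0 x) ?mulr0 ?subr0 //.
  by apply: contraTneq xk => ->; rewrite -leqNgt.
- move=> v xv; rewrite g'0 // (coef0 v) ?mulr0 ?subr0 //; last exact: leq_trans (ltnW xv).
  by apply: contraTneq xv => ->; rewrite -leqNgt.
- move=> v vk nv; have [->|vz] := eqVneq v z; first by rewrite divfK ?subrr.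
  rewrite (coef0 v) ?mulr0 ?subr0 // ?zn //; apply: g'k => //.
  have : s v != s z by apply: contra vz => /eqP/s_inj ->.
  by move: nv; rewrite zn; lia.
- move=> w wk; rewrite sumrB -mulr_sumr mE ?mulr0 ?subr0 ?g'E //.
  exact: leq_trans zk.
Qed.

Lemma cov_up_pivot_le x y g h :
  g x != 0 -> (forall z, (s x < s z)%N -> g z = 0) ->
  (forall w, (s y < s w)%N -> \sum_(z | (z <= w)%O) g z = 0) ->
  (forall w, (s w < s y)%N -> h w = 0) ->
  (forall z, (s z < s x)%N -> \sum_(w | (z <= w)%O) h w = 0) ->
  \sum_(w | (x <= w)%O) h w != 0 ->
  (#|cov_up y| <= #|cov_down x|)%N.
Proof.
move=> gx g0 Wg0 h0 hW0 hWx; rewrite leqNgt; apply/negP => ltxy.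
have [g' [g'x g'0 g'k g'E]] := eliminate_columns ltxy g0.
(* A row with few upper covers is not y itself, so the hypothesis on g applies. For another row, the
   annihilator of w kills every column where g' can be nonzero, and by induction only the term of w
   remains in the pairing. *)
have Wg'0 w : (s y <= s w)%N -> \sum_(z | (z <= w)%O) g' z = 0.
  elim/gt_ind: w => w IH yw.
  have [wk|wk] := ltnP #|cov_up w| #|cov_up y|.
    rewrite g'E // Wg0 // ltn_neqAle yw andbT.
    by apply: contraTneq wk => /s_inj ->; rewrite ltnn.
  have [m [mw m0 mE]] := ex_up_annihilator hR F w.
  have := sum_mul_down_up g' m; rewrite [RHS]big1 => [|z _]; last first.
    have [zk|zk] := ltnP #|cov_down z| #|cov_up y|; last by rewrite g'k ?mul0r.
    by rewrite mE ?mulr0 //; apply: leq_trans wk.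
  rewrite (bigD1 w) //= [X in _ + X]big1 ?addr0 => [/eqP|v vw].
    by rewrite mulf_eq0 (negbTE mw) /= => /eqP.
  have [wv|wv] := boolP (w <= v)%O; last by rewrite m0 ?mul0r.
  rewrite IH ?mulr0 //; first by rewrite lt_neqAle eq_sym vw.
  exact: leq_trans (s_mono wv).
(* The product h W g' is 0 when summed over rows. Summed over columns, only x contributes: h W
   vanishes before x and g' after it. *)
have := sum_mul_down_up g' h; rewrite big1 => [|w _]; last first.
  by have [/h0 ->|/Wg'0 ->] := ltnP (s w) (s y); rewrite ?mul0r ?mulr0.
rewrite (bigD1 x) //= [X in _ + X]big1 ?addr0 => [/esym/eqP|z zx].
  by rewrite mulf_eq0 g'x (negbTE gx) (negbTE hWx).
have [/hW0 ->|] := ltnP (s z) (s x); first by rewrite mulr0.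
rewrite leq_eqVlt => /predU1P[/s_inj xz|/g'0 ->]; last by rewrite mul0r.
by rewrite xz eqxx in zx.
Qed.

End Pivot.

(** * Existence of the Bruhat decomposition *)

Section BruhatExistence.
Variables (F : fieldType) (n : nat).
Implicit Types (A B U V : 'M[F]_n) (i j k r c p : 'I_n).

Lemma borelP B : borel B <->
  (forall r c, (c < r)%N -> B r c = 0) /\ (forall r, B r r != 0).
Proof.
have trigP : is_trig_mx B^T <-> forall r c, (c < r)%N -> B r c = 0.
  split=> [/is_trig_mxP h r c /h|h]; first by rewrite mxE.
  by apply/is_trig_mxP => r c /h; rewrite mxE.
have unitE : is_trig_mx B^T -> (B \in unitmx) = [forall r, B r r != 0].
  move=> tB; rewrite unitmxE -det_tr (det_trig tB) unitfE prodf_seq_neq0.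
  apply/allP/forallP => [h r|h r _]; first by have := h r (mem_index_enum _); rewrite /= mxE.
  by rewrite /= mxE.
split=> [[uB tB]|[/trigP tB dB]].
  by split; [apply/trigP | apply/forallP; rewrite -unitE].
by split=> //; rewrite unitE //; apply/forallP.
Qed.

Lemma borel1 : borel (1%:M : 'M[F]_n).
Proof.
apply/borelP; split=> [r c cr|r]; last by rewrite mxE eqxx oner_eq0.
by rewrite mxE; case: eqP cr => // ->; rewrite ltnn.
Qed.

Lemma borelM U V : borel U -> borel V -> borel (U *m V).
Proof.
move=> [uU tU] [uV tV]; split; first by rewrite unitmx_mul uU.
apply/is_trig_mxP => i j ij; rewrite mxE mxE big1 // => k _.
have [ik|ki] := ltnP i k.
  by have /is_trig_mxP/(_ i k ik) := tV; rewrite mxE => ->; rewrite mulr0.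
have /is_trig_mxP/(_ k j (leq_ltn_trans ki ij)) := tU.
by rewrite mxE => ->; rewrite mul0r.
Qed.

Lemma borelV B : borel B -> borel (invmx B).
Proof.
move=> bB; have [uB _] := bB; have /borelP[tB dB] := bB.
split; first by rewrite unitmx_inv.
(* Induction on the number m of bottom rows treated: the (r, c) entry of B *m invmx B reduces to its
   diagonal term once the rows below r are known. *)
suff h m r c : (n - m <= r)%N -> (c < r)%N -> invmx B r c = 0.
  by apply/is_trig_mxP => c r cr; rewrite mxE (h n) // subnn.
elim: m r => [|m IH] r; first by rewrite subn0 leqNgt ltn_ord.
move=> nr cr; have := congr1 (fun X : 'M_n => X r c) (mulmxV uB).
rewrite mxE [RHS]mxE (_ : (r == c) = false); last first.
  by apply/eqP => rc; rewrite rc ltnn in cr.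
rewrite (bigD1 r) //= big1 ?addr0 => [/eqP|k kr].
  by rewrite mulf_eq0 (negbTE (dB r)) => /eqP.
have [lt_kr|le_rk] := ltnP k r; first by rewrite tB ?mul0r.
have lt_rk : (r < k)%N by rewrite ltn_neqAle le_rk andbT eq_sym.
by rewrite IH ?mulr0 // ?(ltn_trans cr) //; move: nr lt_rk; lia.
Qed.

Definition isolated A i j := [/\ A i j = 1, forall r, r != i -> A r j = 0 &
  forall c, c != j -> A i c = 0].

(* The pivot [i] is the last nonzero row of column [k], which makes the matrix
   clearing the rest of the column upper triangular. *)
Lemma isolate_column A k : A \in unitmx ->
  (forall j, (j < k)%N -> exists i, isolated A i j) ->
  exists U V A', [/\ borel U, borel V, A = U *m A' *m V &
    forall j, (j <= k)%N -> exists i, isolated A' i j].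
Proof.
move=> uA iso.
have [i0 Ai0] : exists i, A i k != 0.
  apply: contrapT => h; have : A *m delta_mx k k = 0.
    apply/matrixP => r c; rewrite !mxE big1 // => j _; rewrite mxE.
    case: eqP => [->|]; rewrite ?mulr0 //.
    suff -> : A r k = 0 by rewrite mul0r.
    by apply/eqP; apply: contrapT => /negP h'; apply: h; exists r.
  move/(congr1 (mulmx (invmx A))); rewrite mulKmx // mulmx0 => /matrixP/(_ k k).
  by rewrite !mxE !eqxx => /eqP; rewrite oner_eq0.
have [i Ai maxi] := @arg_maxnP _ i0 (fun i => A i k != 0) (@nat_of_ord n) Ai0.
have below r : (i < r)%N -> A r k = 0.
  by move=> ir; apply: contraTeq ir => /maxi; rewrite -leqNgt.
have Aij j : (j < k)%N -> A i j = 0.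
  move=> jk; have [p [pj1 pj pr]] := iso j jk.
  apply: pj; apply: contraNneq Ai => ->; rewrite pr //.
  by apply/eqP => kj; rewrite kj ltnn in jk.
(* U carries column k of A and V its row i divided by the pivot; A' is the Schur complement with row
   i and column k replaced by unit vectors. By [Aij], V is upper triangular. *)
pose U : 'M[F]_n := \matrix_(r, c) if c == i then A r k else (r == c)%:R.
pose V : 'M[F]_n := \matrix_(r, c) if r == k then A i c / A i k else (r == c)%:R.
pose A' : 'M[F]_n := \matrix_(r, c) if r == i then (c == k)%:R else
  if c == k then 0 else A r c - A r k * A i c / A i k.
exists U, V, A'; split.
- apply/borelP; split=> [r c cr|r]; rewrite mxE.
    by case: eqP => [ci|_]; [apply: below; rewrite -ci | case: eqP cr => // ->; rewrite ltnn].
  by have [->|_] := eqVneq r i; rewrite // eqxx oner_eq0.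
- apply/borelP; split=> [r c cr|r]; rewrite mxE.
    case: eqP => [rk|_]; last by case: eqP cr => // ->; rewrite ltnn.
    by rewrite Aij ?mul0r // -rk.
  by have [->|_] := eqVneq r k; rewrite ?divff ?eqxx ?oner_eq0.
- have UA' r c : (U *m A') r c = A r k * (c == k)%:R + (r != i)%:R * A' r c.
    rewrite mxE (bigD1 i) //= !mxE !eqxx; congr (_ + _).
    have [->|ri] := eqVneq r i.
      rewrite mul0r big1 // => j ji; rewrite mxE (negbTE ji) eq_sym (negbTE ji).
      by rewrite mul0r.
    rewrite (bigD1 r) //= big1 ?addr0 => [|j /andP[ji jr]].
      by rewrite !mxE (negbTE ri) eqxx.
    by rewrite mxE (negbTE ji) eq_sym (negbTE jr) mul0r.
  apply/matrixP => r c; rewrite mxE (bigD1 k) //= UA' [V _ _]mxE eqxx mulr1.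
  have A'k : (r != i)%:R * A' r k = 0.
    by rewrite mxE eqxx; case: (r == i); rewrite ?mul0r ?mulr0.
  rewrite A'k addr0; have [->|ck] := eqVneq c k.
    rewrite divff // mulr1 big1 ?addr0 // => j jk.
    by rewrite [V _ _]mxE (negbTE jk) mulr0.
  rewrite (bigD1 c) //= big1 ?addr0 => [|j /andP[jk jc]]; last first.
    by rewrite [V _ _]mxE (negbTE jk) (negbTE jc) mulr0.
  rewrite UA' (negbTE ck) mulr0 add0r !mxE (negbTE ck) eqxx mulr1.
  have [->|ri] := eqVneq r i; first by rewrite mul0r addr0 mulrCA divff ?mulr1.
  by rewrite mul1r mulrA addrC subrK.
- move=> j; rewrite leq_eqVlt => /predU1P[/val_inj ->|jk].
    exists i; split=> [|r ri|c ck]; rewrite mxE ?eqxx //.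
      by rewrite (negbTE ri).
    by rewrite (negbTE ck).
  have nkj : k != j by apply: contraTneq jk => ->; rewrite ltnn.
  have [p [pj1 pj pr]] := iso j jk; exists p.
  have npi : p != i by apply: contraNneq Ai => <-; rewrite pr.
  have njk : j != k by rewrite eq_sym.
  split=> [|r rp|c cj].
  + by rewrite mxE (negbTE npi) (negbTE njk) pj1 pr // !mul0r subr0.
  + rewrite mxE (negbTE njk); case: ifP => // _.
    by rewrite pj // Aij // mulr0 mul0r subr0.
  + rewrite mxE (negbTE npi); case: ifP => // _.
    by rewrite pr // pr // !mul0r subr0.
Qed.

Lemma bruhat_exists A : A \in unitmx -> exists P, is_perm_mx P /\ in_bruhat_cell P A.
Proof.
move=> uA.
have H (k : nat) : (k <= n)%N -> exists U V A', [/\ borel U, borel V, A = U *m A' *m V &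
    forall j, (j < k)%N -> exists i, isolated A' i j].
  elim: k => [_|k IH kn].
    by exists 1%:M, 1%:M, A; split; rewrite ?mul1mx ?mulmx1 //; apply: borel1.
  have [U [V [A' [bU bV AE iso]]]] := IH (ltnW kn).
  have uA' : A' \in unitmx.
    by move: uA; rewrite AE !unitmx_mul => /andP[/andP[]].
  have [U' [V' [A'' [bU' bV' A'E iso']]]] := @isolate_column A' (Ordinal kn) uA' iso.
  exists (U *m U'), (V' *m V), A''; split; [exact: borelM | exact: borelM | | exact: iso'].
  by rewrite AE A'E !mulmxA.
have [U [V [P [bU bV AE iso]]]] := H n (leqnn n).
exists P; split; last by exists U, V.
have [p pP] := choice (fun j => iso j (ltn_ord j)).
have p_inj : injective p.
  move=> j j' pjj'; have [_ _ pr] := pP j; have [pj1 _ _] := pP j'.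
  apply/eqP; apply: contraT => jj'.
  have := oner_neq0 F; by rewrite -pj1 -pjj' pr ?eqxx // eq_sym.
(* The inverse appears because p sends columns to rows, whereas [perm_mx] reads its permutation from
   rows to columns. *)
apply/is_perm_mxP; exists (perm p_inj)^-1%g; apply/matrixP => r c.
rewrite !mxE; have [pc1 pc _] := pP c.
rewrite -(inj_eq (@perm_inj _ (perm p_inj))) permKV permE.
by have [->|/pc ->] := eqVneq r (p c).
Qed.

End BruhatExistence.

(** * Bruhat factors of the Cartan matrix and echelonmotion *)

Section EchelonmotionPivot.
Variables (K : realType) (d : Order.disp_t) (R : finLatticeType d).
Variable sigma : linear_extension R.
Local Notation W := (cartan_mx K sigma).
Local Notation n := #|R|.

Lemma lext_bij : bijective sigma.
Proof. exact: Bijective (lextK sigma) (lext_invK sigma). Qed.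

Lemma cartan_mxE x y : W (sigma x) (sigma y) = ((y <= x)%O)%:R.
Proof. by rewrite mxE !lextK. Qed.

Lemma cartan_mx_unit : W \in unitmx.
Proof.
rewrite -unitmx_tr; suff [] : borel W^T by [].
apply/borelP; split=> [r c cr|r]; rewrite !mxE; last by rewrite lexx oner_eq0.
case: (boolP (_ <= _)%O) => // /(lext_mono sigma).
by rewrite !lext_invK leqNgt cr.
Qed.

Lemma cartan_mul (X : 'M[K[i]]_n) w j :
  (W *m X) (sigma w) j = \sum_(z | (z <= w)%O) X (sigma z) j.
Proof.
rewrite mxE (reindex _ (onW_bij _ lext_bij)) /= [RHS]big_mkcond.
by apply: eq_bigr => z _; rewrite cartan_mxE; case: ifP; rewrite ?mul1r ?mul0r.
Qed.

Lemma mul_cartan (X : 'M[K[i]]_n) i z :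
  (X *m W) i (sigma z) = \sum_(w | (z <= w)%O) X i (sigma w).
Proof.
rewrite mxE (reindex _ (onW_bij _ lext_bij)) /= [RHS]big_mkcond.
by apply: eq_bigr => w _; rewrite cartan_mxE; case: ifP; rewrite ?mulr1 ?mulr0.
Qed.

(** Existence of the decomposition guarantees that [xget] does not return its default 0. *)
Lemma bruhat_perm_cartan : exists s : 'S_n,
  bruhat_perm_mx W = perm_mx s /\ in_bruhat_cell (perm_mx s) W.
Proof.
have [/is_perm_mxP[s Es] cell] := xgetPex 0 (bruhat_exists cartan_mx_unit).
by exists s; rewrite -Es.
Qed.

Lemma cov_up_bruhat_le (s : 'S_n) x y : modular_lattice R ->
  in_bruhat_cell (perm_mx s) W -> s (sigma y) = sigma x ->
  (#|cov_up y| <= #|cov_down x|)%N.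
Proof.
move=> hR [B1 [B2 [bB1 bB2 WE]]] sy.
have [[uB1 _] [uB2 _]] := (bB1, bB2).
have /borelP[t1 _] := bB1; have /borelP[t2 d2] := bB2.
have /borelP[t1' _] := borelV bB1; have /borelP[t2' d2'] := borelV bB2.
have EW : W *m invmx B2 = col_perm s^-1 B1.
  by rewrite WE mulmxK // col_permE invgK.
have WE' : invmx B1 *m W = row_perm s B2 by rewrite WE -mulmxA mulKmx // row_permE.
(* Column x of W B2^-1 = B1 P is column y of B1, hence zero below row y. Row y of B1^-1 W = P B2 is
   row x of B2, hence zero before column x and nonzero there. *)
apply: (@cov_up_pivot_le _ _ K[i] hR (fun z => sigma z) _ (lext_mono sigma) x y
  (fun z => invmx B2 (sigma z) (sigma x)) (fun w => invmx B1 (sigma y) (sigma w))).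
- exact: inj_comp val_inj (can_inj (lextK sigma)).
- exact: d2'.
- by move=> z; apply: t2'.
- by move=> w yw; rewrite -cartan_mul EW mxE -sy permK t1.
- by move=> w; apply: t1'.
- by move=> z zx; rewrite -mul_cartan WE' mxE sy t2.
- by rewrite -mul_cartan WE' mxE sy d2.
Qed.

Lemma perm_echelonmotion (s : 'S_n) x : bruhat_perm_mx W = perm_mx s ->
  s (sigma (echelonmotion K sigma x)) = sigma x.
Proof.
move=> Es; rewrite /echelonmotion Es; case: pickP => [y|none].
  by rewrite !mxE; have [//|_] := eqVneq (s _) (sigma x); rewrite eq_sym oner_eq0.
(* Column x of the permutation matrix has its 1 in this row, so the default of [echelonmotion] is
   excluded. *)
have := none (lext_inv sigma ((s^-1)%g (sigma x))).
by rewrite !mxE lext_invK permKV eqxx eqxx.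
Qed.

End EchelonmotionPivot.

Lemma sum_cov_down_up (d : Order.disp_t) (R : finPOrderType d) :
  (\sum_(x : R) #|cov_down x| = \sum_(x : R) #|cov_up x|)%N.
Proof.
transitivity (\sum_(x : R) \sum_(y : R) covered_by y x)%N.
  apply: eq_bigr => x _; rewrite -sum1_card [LHS]big_mkcond.
  by apply: eq_bigr => y _; rewrite inE.
rewrite exchange_big; apply: eq_bigr => y _; rewrite -sum1_card [RHS]big_mkcond.
by apply: eq_bigr => x _; rewrite inE.
Qed.

End EchelonmotionCovers.

Theorem theorem2p1 (K : realType) (d : Order.disp_t) (R : finLatticeType d)
    (sigma : linear_extension R) (hR : modular_lattice R) (x : R) :
  #|cov_up (echelonmotion K sigma x)| = #|cov_down x|.
Proof.
have [s [Es cell]] := bruhat_perm_cartan K sigma.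
have ech y := perm_echelonmotion y Es.
have ech_inj : injective (echelonmotion K sigma).
  by move=> y z yz; apply: (can_inj (lextK sigma)); rewrite -ech yz ech.
have le y : #|cov_up (echelonmotion K sigma y)| <= #|cov_down y| ?=
    iff (#|cov_up (echelonmotion K sigma y)| == #|cov_down y|).
  by split=> //; apply: cov_up_bruhat_le hR cell (ech y).
(* Termwise inequalities with equal sums are equalities; the sums agree after reindexing along the
   bijection [echelonmotion]. *)
have [_] := leqif_sum (fun y (_ : predT y) => le y).
rewrite sum_cov_down_up [X in _ == X](reindex_inj ech_inj) eqxx.
by move/esym/forallP/(_ x)/eqP.
Qed.
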